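(* For every integer $N\ge1$ and every $\sigma\in[0,\sqrt N]$, $$\left(1-\frac52\cdot\frac{\log(N+1)}N\right)u(\sigma)\le\ell_N(\sigma)\le u_N^{\mathbb S}(\sigma)\le u_N^{\mathbb L}(\sigma)\le u(\sigma).$$
   Context: The functions are defined as follows (each $\min$ denotes the optimal value, i.e. infimum). $\bullet$ $u(\sigma)\ge1$ is the solution $u\ge1$ of $\sigma^2=u^2-1-2\log u$. $\bullet$ $\ell_N(\sigma)=\sqrt{1+N\nu}$, where $\nu\in[0,1]$ is the unique solution of $\sum_{k=0}^{N-1}\frac{(N-k)\nu^2}{1+(N-(k+1))\nu}=\sigma^2$. $\bullet$ $(u_N^{\mathbb L}(\sigma))^2=\min\Big\{\frac{\sigma^2+\sum_{k=0}^Ny_k}{(N+1)y_0}:\ y_0>0,\ y_{k+1}\ge y_k+y_k^2\ \forall k\in\{0,\dots,N-1\}\Big\}$, with $u_N^{\mathbb L}(\sigma)\geq 0$. $\bullet$ $u_N^{\mathbb S}(\sigma)=\sqrt{N+1}\cdot\min\Big\{\tau\sigma^2+\nu_\star+\sum_{k=0}^N\nu_k:\ \alpha\in\mathbb R_{\ge0}^N,\ \tau\ge0,\ \nu_\star,\nu_0,\dots,\nu_N\ge0,\ \Lambda(\nu,\tau,\alpha L/R)\succeq0\Big\}$, where $L,R>0$ are fixed constants (on which the value does not depend). For $a=(a_0,\dots,a_{N-1})$, $\Lambda(\nu,\tau,a)$ is the symmetric $(2N+2)\times(2N+2)$ matrix with rows and columns indexed by $\star,0,1,\dots,N,\epsilon_0,\dots,\epsilon_{N-1}$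 and entries: $\Lambda_{\star\star}=\nu_\star$; $\Lambda_{\star k}=-\frac1{2(N+1)}$ for $0\le k\le N$; $\Lambda_{kk}=\nu_k$ for $0\le k\le N$; $\Lambda_{jk}=\frac{a_j}{2(N-j)}$ for $0\le j<k\le N$; $\Lambda_{\star\epsilon_j}=0$; $\Lambda_{k\epsilon_j}=\frac{a_j}{2(N-j)}$ if $j<k$ and $0$ if $j\ge k$ ($0\le k\le N$, $0\le j\le N-1$); $\Lambda_{\epsilon_j\epsilon_j}=\tau$; $\Lambda_{\epsilon_i\epsilon_j}=0$ for $i\ne j$. *)

(* Defs.v *)
From HB Require Import structures.
From mathcomp Require Import all_boot all_order all_algebra.
From mathcomp Require Import all_classical all_reals all_analysis.

Set Implicit Arguments.
Unset Strict Implicit.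
Unset Printing Implicit Defensive.

Import Order.TTheory GRing.Theory Num.Theory.

Local Open Scope classical_set_scope.
Local Open Scope ring_scope.

(* The equation has exactly one root in [1, +oo[ for every sigma, so the
   default value of xget is never returned. *)
Definition u {R : realType} (sigma : R) : R :=
  xget 1 [set v : R | 1 <= v /\ sigma ^+ 2 = v ^+ 2 - 1 - 2 * ln v].

(* The left-hand side increases from 0 to N as nu runs over [0, 1]: there is
   exactly one root when 0 < N and 0 <= sigma <= sqrt N. *)
Definition ell_nu {R : realType} (N : nat) (sigma : R) : R :=
  xget 0 [set nu : R | 0 <= nu <= 1 /\
    \sum_(k < N) ((N - k)%:R * nu ^+ 2) / (1 + (N - k.+1)%:R * nu)
      = sigma ^+ 2].

Definition ell {R : realType} (N : nat) (sigma : R) : R :=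
  Num.sqrt (1 + N%:R * ell_nu N sigma).

(* inf is the real-valued infimum; the two sets to which it is applied in this
   file are nonempty and bounded below by 0. *)
Definition uL {R : realType} (N : nat) (sigma : R) : R :=
  Num.sqrt (inf
    [set v : R | exists y : N.+1.-tuple R,
      [/\ 0 < y`_0,
          forall k, (k < N)%N -> y`_k + y`_k ^+ 2 <= y`_k.+1 &
          v = (sigma ^+ 2 + \sum_(k < N.+1) y`_k) / (N.+1%:R * y`_0)]]).

Definition psd {R : realType} (n : nat) (M : 'M[R]_n) : Prop :=
  M^T = M /\ forall x : 'cV[R]_n, 0 <= (x^T *m M *m x) 0 0.

Section Lambda.
Context {R : realType} (N : nat).
Variables (nustar : R) (nu : N.+1.-tuple R) (tau : R) (a : N.-tuple R).

Definition Lambda_coef (j : nat) : R := a`_j / (2 * (N - j)%:R).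

Definition Lambda_star : 'rV[R]_N.+1 := const_mx (- (1 / (2 * N.+1%:R))).

Definition Lambda_points : 'M[R]_N.+1 :=
  \matrix_(j, k) if j == k then nu`_k else Lambda_coef (minn j k).

Definition Lambda_eps : 'M[R]_(N.+1, N) :=
  \matrix_(k, j) if (j < k)%N then Lambda_coef j else 0.

(* The rows and columns are ordered as star, 0, ..., N, eps_0, ...,
   eps_(N-1); the dimension 1 + N.+1 + N is 2N + 2. *)
Definition Lambda : 'M[R]_(1 + N.+1 + N) :=
  block_mx
    (block_mx nustar%:M     Lambda_star
              Lambda_star^T Lambda_points)   (col_mx 0 Lambda_eps)
    (col_mx 0 Lambda_eps)^T                  tau%:M.

End Lambda.

Definition uS {R : realType} (L D : R) (N : nat) (sigma : R) : R :=
  Num.sqrt N.+1%:R * inf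
    [set v : R | exists (alpha : N.-tuple R) (tau nustar : R)
                        (nu : N.+1.-tuple R),
      [/\ forall j, (j < N)%N -> 0 <= alpha`_j,
          0 <= tau,
          0 <= nustar /\ (forall k, (k < N.+1)%N -> 0 <= nu`_k),
          psd (Lambda nustar nu tau [tuple alpha`_j * L / D | j < N]) &
          v = tau * sigma ^+ 2 + nustar + \sum_(k < N.+1) nu`_k]].

(* Main.v *)
Require Import Defs.
From HB Require Import structures.
From mathcomp Require Import all_boot all_order all_algebra.
From mathcomp Require Import all_classical all_reals all_analysis.
From mathcomp Require Import ring lra.

Set Implicit Arguments.
Unset Strict Implicit.
Unset Printing Implicit Defensive.

Import Order.TTheory GRing.Theory Num.Theory.
Import numFieldNormedType.Exports.

Local Open Scope ring_scope.

(** The chain splits into four independent comparisons.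

    [uL <= u]: the difference inequality y_(k+1) >= y_k + y_k^2 is a
    discretisation of y' = y^2, so it is met by the hyperbola y_k = 1/(c - k),
    c > N.  The sum of the y_k is at most ln (c / (c - (N + 1))), and
    c = (N + 1) u^2 / (u^2 - 1) makes that logarithm equal to 2 ln u; the
    equation defining u then turns the objective into u^2 ([uL_le_u]).  At
    sigma = 0 this c is infinite, and one lets c tend to infinity instead.

    [uS <= uL]: from a feasible y one builds feasible multipliers
    (tau, nu_k, nu_star) = (c, c y_k, 1 / (4 (N + 1)^2 c y_0)).  The
    off-diagonal entries carry c times the least such sequence starting at
    y_0, namely b_(k+1) = b_k + b_k^2, b_0 = y_0.  For these data the
    quadratic form of the matrix is a sum of squares
    ([lambda_form_min_growth]); eliminating the noise variables eps_j one at a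
    time is what forces the recurrence on b.  Optimising over the scale c
    turns the sum tau sigma^2 + nu_star + sum nu_k into the square root
    defining uL.

    [ell <= uS]: this is weak duality.  Take unit vectors g_0, ..., g_N with
    all pairwise inner products equal to z = ell_nu, a unit vector along their
    sum for the index star, and
    eps_j = - t_j (g_(j+1) + ... + g_N), with t_j making g_j + eps_j
    orthogonal to g_(j+1) + ... + g_N.  Pairing their Gram matrix with the
    positive semidefinite matrix Lambda kills every step size, and the
    equation defining z says exactly that the squared norms of the eps_j add
    up to sigma^2 ([lambda_form_lower]).

    The lower bound on [ell]: with w = ell^2 = 1 + N z, a telescoping estimate
    gives sigma^2 <= w - 1 - (1 - z) ln w ([ell_sum_le]), while
    sigma^2 = W - 1 - ln W for W = u^2.  As x - 1 - ln x is convex, the tangent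
    at w bounds W by w (1 + x) with x = ln (N + 1) / N ([u_ell_le]).  Finally
    (1 - 5 x / 2)^2 (1 + x) <= 1 as long as 1 - 5 x / 2 >= 0. *)

(** * The lower bound on ell *)

Lemma ln_le_subr1 (R : realType) (x : R) : 0 < x -> ln x <= x - 1.
Proof.
by move=> x0; have := @le_ln1Dx R (x - 1); rewrite subrKC; apply; lra.
Qed.

Lemma ln_le_tangent (R : realType) (x y : R) :
  0 < x -> 0 < y -> ln y <= ln x + (y - x) / x.
Proof.
move=> x0 y0; have xN0 : x != 0 by rewrite gt_eqF.
rewrite -lerBlDl -ln_div ?posrE//.
have := ln_le_subr1 (divr_gt0 y0 x0).
by congr (_ <= _); field.
Qed.

(** Existence is by the intermediate value theorem on [1, 1 + sigma]: the bound
    ln v <= v - 1 makes v^2 - 1 - 2 ln v at least (v - 1)^2. *)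
Lemma u_spec (R : realType) (sigma : R) : 0 <= sigma ->
  1 <= u sigma /\ sigma ^+ 2 = u sigma ^+ 2 - 1 - 2 * ln (u sigma).
Proof.
move=> s0; apply: (xgetPex 1
  (P := [set v | 1 <= v /\ sigma ^+ 2 = v ^+ 2 - 1 - 2 * ln v]%classic)).
pose f : R -> R := fun v => v ^+ 2 - 1 - 2 * ln v.
have f1 : f 1 = 0 by rewrite /f ln1; lra.
have fB : sigma ^+ 2 <= f (1 + sigma).
  have := @ln_le_subr1 R (1 + sigma); rewrite /f; nra.
have cf : {within `[1, 1 + sigma], continuous f}%classic.
  apply: continuous_in_subspaceT => x.
  rewrite inE/= in_itv/= => /andP[x1 _].
  have x0 : 0 < x by lra.
  apply: cvgD; last first.
    by apply: cvgN; apply: cvgM; [exact: cvg_cst | exact: continuous_ln].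
  by apply: cvgD; [exact: exprn_continuous | exact: cvg_cst].
have [||v] := IVT (v := sigma ^+ 2) _ cf; first lra.
  have := sqr_ge0 sigma; rewrite f1 => ?.
  by rewrite ge_min le_max; apply/andP; split; apply/orP; [left | right].
by rewrite in_itv/= => /andP[v1 _] fv; exists v.
Qed.

Section EllSum.
Variable R : realType.
Implicit Types (N : nat) (nu sigma : R).

Lemma ell_sum_rev N nu :
  \sum_(k < N) ((N - k)%:R * nu ^+ 2) / (1 + (N - k.+1)%:R * nu)
  = \sum_(i < N) (i.+1%:R * nu ^+ 2) / (1 + i%:R * nu).
Proof.
rewrite (reindex_inj rev_ord_inj)/=; apply: eq_bigr => i _.
by rewrite subnSK// subKn ?subKn// ltnW.
Qed.

Lemma ell_nu_spec N sigma : 0 <= sigma -> sigma <= Num.sqrt N%:R ->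
  0 <= ell_nu N sigma <= 1 /\
  \sum_(k < N) ((N - k)%:R * ell_nu N sigma ^+ 2) /
     (1 + (N - k.+1)%:R * ell_nu N sigma) = sigma ^+ 2.
Proof.
move=> s0 sN; apply: (xgetPex 0 (P := [set nu | 0 <= nu <= 1 /\
  \sum_(k < N) ((N - k)%:R * nu ^+ 2) / (1 + (N - k.+1)%:R * nu)
    = sigma ^+ 2]%classic)).
pose F (n : nat) : R -> R := fun nu => \sum_(i < n) (i.+1%:R * nu ^+ 2) / (1 + i%:R * nu).
have F0 : F N 0 = 0.
  by rewrite /F big1 // => i _; rewrite expr0n/= mulr0 mul0r.
have F1 : F N 1 = N%:R.
  rewrite /F (eq_bigr (fun=> 1)) ?sumr_const ?card_ord// => i _.
  by rewrite expr1n !mulr1 nat1r divff// pnatr_eq0.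
have cF n : {within `[0, 1], continuous (F n)}%classic.
  apply: continuous_in_subspaceT => x.
  rewrite inE/= in_itv/= => /andP[x0 _].
  elim: n => [|n IH].
    rewrite (_ : F 0%N = fun=> 0); last by apply/funext => y; rewrite /F big_ord0.
    exact: cvg_cst.
  rewrite (_ : F n.+1 = fun y => F n y + (n.+1%:R * y ^+ 2) / (1 + n%:R * y));
    last by apply/funext => y; rewrite /F big_ord_recr.
  have d0 : 1 + n%:R * x != 0.
    by rewrite gt_eqF// ltr_wpDr// mulr_ge0.
  apply: cvgD; first exact: IH.
  apply: cvgM.
    by apply: cvgM; [exact: cvg_cst | exact: exprn_continuous].
  apply: cvgV => //; apply: cvgD; first exact: cvg_cst.
  by apply: cvgM; [exact: cvg_cst | exact: cvg_id].
have [||nu] := IVT (v := sigma ^+ 2) _ (cF N); first lra.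
  have s2 : sigma ^+ 2 <= N%:R.
    by rewrite -(sqr_sqrtr (ler0n R N)) ler_sqr// nnegrE sqrtr_ge0.
  have := sqr_ge0 sigma; rewrite F0 F1 => ?.
  by rewrite ge_min le_max; apply/andP; split; apply/orP; [left | right].
rewrite in_itv/= => nu01 Fnu; exists nu; split => //.
by rewrite ell_sum_rev.
Qed.

(** The summand of index i is nu - (1 - nu) nu / (1 + i nu), and
    nu / (1 + i nu) dominates the increment of ln from 1 + i nu to
    1 + (i + 1) nu. *)
Lemma ell_sum_le N nu : 0 <= nu <= 1 ->
  \sum_(i < N) (i.+1%:R * nu ^+ 2) / (1 + i%:R * nu)
  <= N%:R * nu - (1 - nu) * ln (1 + N%:R * nu).
Proof.
move=> /andP[nu0 nu1]; elim: N => [|n IH].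
  by rewrite big_ord0 !mul0r addr0 ln1 mulr0 subr0.
rewrite big_ord_recr/= -nat1r; set x : R := n%:R in IH *.
have x0 : 0 <= x by exact: ler0n.
have d0 : 0 < 1 + x * nu by rewrite ltr_wpDr// mulr_ge0.
have d1 : 0 < 1 + (1 + x) * nu by nra.
have := ln_le_tangent d0 d1.
have -> : 1 + (1 + x) * nu - (1 + x * nu) = nu by ring.
have -> : (1 + x) * nu ^+ 2 / (1 + x * nu) = nu - (1 - nu) * (nu / (1 + x * nu)).
  by field; rewrite gt_eqF.
move: IH; set S := \sum_(i < n) _; set t := nu / _.
set l1 := ln _; set l2 := ln _; nra.
Qed.

End EllSum.

(** The error term nu ln w of [ell_sum_le] equals (w - 1) ln w / N, and the
    slope of x - 1 - ln x at w is (w - 1) / w.  The factors w - 1 cancel, which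
    leaves u^2 - w <= w ln w / N.  At w = 1 itself the
    slope vanishes, and sigma = 0 forces u = 1 directly. *)
Lemma u_ell_le (R : realType) (N : nat) (sigma : R) :
  (1 <= N)%N -> 0 <= sigma -> sigma <= Num.sqrt N%:R ->
  u sigma ^+ 2 <= ell N sigma ^+ 2 * (1 + ln (N%:R + 1) / N%:R).
Proof.
move=> N1 s0 sN.
have [u1 us] := u_spec s0.
have [/andP[nu0 nu1]] := ell_nu_spec s0 sN.
rewrite ell_sum_rev /ell; set nu := ell_nu N sigma in nu0 nu1 * => Fs.
have := @ell_sum_le R N nu; rewrite nu0 nu1 Fs => /(_ isT).
have n0 : 0 < N%:R :> R by rewrite ltr0n.
set n : R := N%:R in n0 *.
set w := 1 + n * nu => sw.
have w1 : 1 <= w by rewrite /w lerDl mulr_ge0// ltW.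
have w0 : 0 < w by lra.
have wn : w <= n + 1 by rewrite /w; nra.
rewrite sqr_sqrtr; last exact: ltW.
set v := u sigma in u1 us *.
have u0 : 0 < v by lra.
have lnv : ln (v ^+ 2) = 2 * ln v by rewrite lnXn// mulr_natl.
have := ln_le_tangent w0 (exprn_gt0 2 u0); rewrite lnv.
have lw : ln w <= ln (n + 1) by rewrite ler_ln// posrE; lra.
have lnw0 : 0 <= ln w by exact: ln_ge0.
have nE : n * nu = w - 1 by rewrite /w; ring.
have nuE : nu = (w - 1) / n by rewrite -nE mulrC mulKf// gt_eqF.
have [w_gt1|w_le1] := ltP 1 w; last first.
  have wE : w = 1 by lra.
  have vu : ln v <= v - 1 by exact: ln_le_subr1.
  have v1 : v = 1.
    have : (v - 1) ^+ 2 <= 0 by move: sw; rewrite nE wE ln1; nra.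
    by rewrite le_eqVlt ltNge sqr_ge0 orbF sqrf_eq0 subr_eq0 => /eqP.
  move=> _; rewrite v1 wE mul1r expr1n lerDl.
  by rewrite divr_ge0 ?(ltW n0)//; apply: ln_ge0; lra.
set X := v ^+ 2 in us *; set lv := ln v in us *.
move=> tan.
have key : (w - 1) * ((X - w) / w) <= (w - 1) * (ln w / n).
  have -> : (w - 1) * ((X - w) / w) = X - w - (X - w) / w.
    by field; rewrite gt_eqF.
  have -> : (w - 1) * (ln w / n) = nu * ln w by rewrite nuE; field; rewrite gt_eqF.
  move: sw; rewrite us nE; nra.
have : (X - w) / w <= ln (n + 1) / n.
  rewrite ler_pM2l in key; last lra.
  by apply: (le_trans key); rewrite ler_pM2r ?invr_gt0.
rewrite ler_pdivrMr//; nra.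
Qed.

Lemma ell_lower_bound (R : realType) (N : nat) (sigma : R) :
  (1 <= N)%N -> 0 <= sigma -> sigma <= Num.sqrt N%:R ->
  (1 - 5 / 2 * (ln (N%:R + 1) / N%:R)) * u sigma <= ell N sigma.
Proof.
move=> N1 s0 sN; have := u_ell_le N1 s0 sN.
have [u1 _] := u_spec s0.
have l0 : 0 <= ell N sigma by exact: sqrtr_ge0.
have : 0 <= ln (N%:R + 1) / N%:R :> R.
  by rewrite divr_ge0// ln_ge0// lerDr.
move: u1 l0; set x := ln _ / _; set v := u sigma; set l := ell N sigma.
move=> v1 l0 x0 vl.
have [d0|d0] := leP (1 - 5 / 2 * x) 0; first by nra.
rewrite -(ler_pXn2r (n := 2))// ?nnegrE//; last by rewrite mulr_ge0; lra.
rewrite exprMn.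
have dx : (1 - 5 / 2 * x) ^+ 2 * (1 + x) <= 1 by nra.
have l20 : 0 <= l ^+ 2 by exact: sqr_ge0.
have d20 : 0 <= (1 - 5 / 2 * x) ^+ 2 by exact: sqr_ge0.
apply: (le_trans (ler_wpM2l d20 vl)).
rewrite mulrCA; nra.
Qed.

(** * uL is at most u *)

Section UpperBound.
Variable R : realType.
Implicit Types (N : nat) (sigma c : R).

Definition uL_set N sigma : set R :=
  [set v : R | exists y : N.+1.-tuple R,
      [/\ 0 < y`_0,
          forall k, (k < N)%N -> y`_k + y`_k ^+ 2 <= y`_k.+1 &
          v = (sigma ^+ 2 + \sum_(k < N.+1) y`_k) / (N.+1%:R * y`_0)]]%classic.

Lemma growth_gt0 N (y : nat -> R) : 0 < y 0%N ->
  (forall k, (k < N)%N -> y k + y k ^+ 2 <= y k.+1) ->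
  forall k, (k <= N)%N -> 0 < y k.
Proof.
move=> y0 yS; elim=> [//|k IH] kN.
by apply: lt_le_trans (yS _ kN); rewrite ltr_pwDl ?sqr_ge0 ?IH// ltnW.
Qed.

Lemma sum_growth_gt0 N (y : nat -> R) : 0 < y 0%N ->
  (forall k, (k < N)%N -> y k + y k ^+ 2 <= y k.+1) ->
  0 < \sum_(k < N.+1) y k.
Proof.
move=> y0 yS; rewrite big_ord_recl ltr_pwDl// sumr_ge0// => k _.
by rewrite ltW// (growth_gt0 y0 yS)// -ltnS ltn_ord.
Qed.

Lemma uL_set_lbound N sigma : has_lbound (uL_set N sigma).
Proof.
exists 0 => v [y [y0 yS ->]].
rewrite divr_ge0 ?mulr_ge0 ?ler0n ?ltW//.
by rewrite ltr_wpDl ?sqr_ge0// (sum_growth_gt0 y0 yS).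
Qed.

(** The sequence y_k = 1 / (c - k) is feasible because
    1 / (x (x + 1)) >= 1 / (x + 1)^2. *)
Lemma uL_set_hyperbola N sigma c : N%:R < c ->
  uL_set N sigma (c * (sigma ^+ 2 + \sum_(k < N.+1) (c - k%:R)^-1) / N.+1%:R).
Proof.
move=> Nc; pose y : N.+1.-tuple R := [tuple (c - (k : 'I_N.+1)%:R)^-1 | k < N.+1].
have yE k : (k < N.+1)%N -> y`_k = (c - k%:R)^-1.
  by move=> kN; rewrite -[k]/(nat_of_ord (Ordinal kN)) -tnth_nth tnth_mktuple.
have c0 : 0 < c by apply: le_lt_trans Nc.
have pos k : (k < N.+1)%N -> 0 < c - k%:R.
  by move=> kN; rewrite subr_gt0; apply: le_lt_trans Nc; rewrite ler_nat.
exists y; split.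
- by rewrite yE// subr0 invr_gt0.
- move=> k kN; rewrite (yE k.+1)// (yE k); last exact: ltnW.
  have := pos k.+1 kN; rewrite -natr1; set x := c - (k%:R + 1) => x0.
  rewrite (_ : c - k%:R = x + 1); last by rewrite /x; ring.
  have -> : x^-1 = (x + 1)^-1 + (x * (x + 1))^-1.
    by field; apply/andP; split; rewrite gt_eqF//; lra.
  by rewrite lerD2l expr2 -invfM lef_pV2 ?posrE; nra.
- rewrite (eq_bigr (fun k : 'I_N.+1 => y`_k)); last by move=> k _; rewrite yE.
  rewrite [in RHS]yE// subr0; field.
  by rewrite gt_eqF//= addrC natr1 pnatr_eq0.
Qed.

Lemma sum_inv_le_ln n c : n%:R < c ->
  \sum_(k < n) (c - k%:R)^-1 <= ln (c / (c - n%:R)).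
Proof.
elim: n => [|n IH] nc.
  by rewrite big_ord0 subr0 divff ?ln1// gt_eqF.
have nn : n%:R < n.+1%:R :> R by rewrite ltr_nat.
have c0 : 0 < c by apply: le_lt_trans nc.
rewrite big_ord_recr/=; have := IH (lt_trans nn nc).
have p1 : 0 < c - n%:R by rewrite subr_gt0 (lt_trans nn nc).
have p2 : 0 < c - n.+1%:R by rewrite subr_gt0.
rewrite !ln_div ?posrE// => Sle.
have := ln_le_tangent p1 p2.
have -> : (c - n.+1%:R - (c - n%:R)) / (c - n%:R) = - (c - n%:R)^-1.
  by rewrite -natr1; field; rewrite gt_eqF.
move: Sle; set S := \sum_(_ < _) _; lra.
Qed.

Lemma uL_le_u N sigma : (1 <= N)%N -> 0 <= sigma -> uL N sigma <= u sigma.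
Proof.
move=> N1 s0; have [u1 us] := u_spec s0.
set v := u sigma in u1 us *.
have inf_le c : N%:R < c -> inf (uL_set N sigma) <=
    c * (sigma ^+ 2 + \sum_(k < N.+1) (c - k%:R)^-1) / N.+1%:R.
  by move=> cN; apply: ge_inf; [exact: uL_set_lbound | exact: uL_set_hyperbola].
rewrite -(@ger0_norm _ v); last lra.
rewrite -sqrtr_sqr /uL; apply: ler_wsqrtr; rewrite -/(uL_set N sigma).
have n0 : 0 < N.+1%:R :> R by rewrite ltr0n.
have [v_gt1|v_le1] := ltP 1 v.
  (* This c is chosen so that c / (c - (N + 1)) = v ^+ 2, which is also the
     minimiser of the bound that sum_inv_le_ln gives. *)
  pose c := N.+1%:R * (v ^+ 2 / (v ^+ 2 - 1)).
  have d0 : 0 < v ^+ 2 - 1 by nra.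
  have cE : c - N.+1%:R = N.+1%:R / (v ^+ 2 - 1) by rewrite /c; field; rewrite gt_eqF.
  have cN : N.+1%:R < c by rewrite -subr_gt0 cE divr_gt0.
  have c0 : 0 < c by apply: lt_trans cN.
  apply: (le_trans (inf_le c _)); first by apply: lt_trans cN; rewrite ltr_nat.
  have := sum_inv_le_ln cN; rewrite cE.
  have -> : c / (N.+1%:R / (v ^+ 2 - 1)) = v ^+ 2.
    by rewrite /c; field; rewrite !gt_eqF.
  rewrite lnXn ?mulr2n; last lra.
  move=> Sle; rewrite ler_pdivrMr//.
  have -> : v ^+ 2 * N.+1%:R = c * (v ^+ 2 - 1) by rewrite /c; field; rewrite gt_eqF.
  by rewrite ler_pM2l// us; lra.
have v1 : v = 1 by lra.
have s2 : sigma ^+ 2 = 0 by rewrite us v1 ln1; ring.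
rewrite v1 expr1n; apply/ler_addgt0Pr => e e0.
have N0 : 0 < N%:R :> R by rewrite ltr0n.
(* Now sigma = 0; bounding each term of the sum by 1 / (c - N), the objective
   is at most c / (c - N), and this c makes that quotient 1 + e. *)
pose c := N%:R * (1 + e) / e.
have cE : c - N%:R = N%:R / e by rewrite /c; field; rewrite gt_eqF.
have cN : N%:R < c by rewrite -subr_gt0 cE divr_gt0.
have c0 : 0 < c by apply: lt_trans cN.
apply: (le_trans (inf_le c cN)); rewrite s2 add0r ler_pdivrMr//.
have Sle : \sum_(k < N.+1) (c - k%:R)^-1 <= N.+1%:R / (c - N%:R).
  rewrite mulr_natl -[N.+1 in leRHS]card_ord -sumr_const; apply: ler_sum => k _.
  have kN : k%:R <= N%:R :> R by rewrite ler_nat -ltnS.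
  by rewrite lef_pV2 ?posrE; lra.
apply: (le_trans (ler_wpM2l (ltW c0) Sle)).
by rewrite cE le_eqVlt; apply/orP; left; apply/eqP; rewrite /c; field; rewrite !gt_eqF.
Qed.

End UpperBound.

(** * The quadratic form of Lambda *)

Section QuadraticForm.
Variables (R : realType) (N : nat).
Implicit Types (nustar tau s : R) (nu c p e : nat -> R).

Definition tail p j : R := \sum_(k < N.+1 | (j <= k)%N) p k.

(** The value of the quadratic form of [Lambda] at the vector with coordinates
    s, p_k and e_j.  Since the entry in position (j, k) depends only on
    min (j, k), the off-diagonal entries see the vector only through the sums
    of the p_k over k > j. *)
Definition lambda_form nustar nu tau c s p e : R :=
  nustar * s ^+ 2 - s * (\sum_(k < N.+1) p k) / N.+1%:R
  + \sum_(k < N.+1) nu k * p k ^+ 2 + tau * \sum_(j < N) e j ^+ 2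
  + 2 * \sum_(j < N) c j * (p j + e j) * tail p j.+1.

Lemma quad_points (nu : N.+1.-tuple R) (a : N.-tuple R) p :
  ((\col_k p k)^T *m (Lambda_points nu a *m \col_k p k)) 0 0
  = \sum_(k < N.+1) nu`_k * p k ^+ 2
    + 2 * \sum_(j < N) Lambda_coef a j * p j * tail p j.+1.
Proof.
pose G (j k : 'I_N.+1) := Lambda_coef a (minn j k) * p j * p k.
have off : \sum_(j < N.+1) \sum_(k < N.+1 | (j < k)%N) G j k =
    \sum_(j < N) Lambda_coef a j * p j * tail p j.+1.
  rewrite big_ord_recr/= [X in _ + X]big_pred0 ?addr0; last first.
    by move=> k; rewrite ltnNge -ltnS ltn_ord.
  apply: eq_bigr => j _; rewrite mulr_sumr; apply: eq_bigr => k jk.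
  by rewrite /G (minn_idPl _)// ltnW.
have off' : \sum_(j < N.+1) \sum_(k < N.+1 | (k < j)%N) G j k =
    \sum_(j < N.+1) \sum_(k < N.+1 | (j < k)%N) G j k.
  rewrite (exchange_big_dep xpredT)//=; apply: eq_bigr => j _.
  by apply: eq_bigr => k _; rewrite /G minnC; ring.
rewrite mulr_natl mulr2n -off -{1}off' -!big_split/= mxE; apply: eq_bigr => j _.
rewrite !mxE mulr_sumr (bigD1 j)//= !mxE eqxx addrA.
rewrite (_ : p j * (nu`_j * p j) = nu`_j * p j ^+ 2); last by ring.
rewrite -addrA; congr (_ + _).
rewrite (bigID (fun k : 'I_N.+1 => (k < j)%N))/=; congr (_ + _).
  apply: eq_big => [k|k /andP[kj _]].
    by rewrite -val_eqE/= ltn_neqAle; case: eqP.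
  by rewrite !mxE eq_sym (negbTE kj) /G; ring.
apply: eq_big => [k|k /andP[kj _]].
  by rewrite -leqNgt -val_eqE/= ltn_neqAle eq_sym.
by rewrite !mxE eq_sym (negbTE kj) /G; ring.
Qed.

Lemma quad_eps (a : N.-tuple R) p e :
  ((\col_k p k)^T *m (Lambda_eps a *m \col_j e j)) 0 0
  = \sum_(j < N) Lambda_coef a j * e j * tail p j.+1.
Proof.
rewrite mxE; under eq_bigr do rewrite !mxE mulr_sumr.
rewrite exchange_big/=; apply: eq_bigr => j _; rewrite mulr_sumr [RHS]big_mkcond/=.
by apply: eq_bigr => k _; rewrite !mxE; case: ifP => _; ring.
Qed.

(** The left-hand side is expanded blockwise; the blocks below the diagonal are
    transposes of those above it and contribute the same scalars. *)
Lemma Lambda_quad nustar (nu : N.+1.-tuple R) tau (a : N.-tuple R) s p e :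
  let x := col_mx (col_mx s%:M (\col_(k < N.+1) p k)) (\col_(j < N) e j) in
  (x^T *m Lambda nustar nu tau a *m x) 0 0
  = lambda_form nustar (nth 0 nu) tau (Lambda_coef a) s p e.
Proof.
rewrite /Lambda; set P := (\col_(k < N.+1) p k); set E := (\col_(j < N) e j).
rewrite -mulmxA !mul_block_col !mul_col_mx !tr_col_mx mul_row_col.
rewrite mul0mx add_col_mx !mul_row_col addr0 trmx0 mul0mx add0r.
set S := (s%:M : 'M[R]_1).
have tr11 (M : 'M[R]_1) : M^T 0 0 = M 0 0 by rewrite mxE.
have starE : (S^T *m (Lambda_star N *m P)) 0 0
    = - (s * (\sum_(k < N.+1) p k) / (2 * N.+1%:R)).
  rewrite /S tr_scalar_mx mul_scalar_mx !mxE.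
  rewrite (eq_bigr (fun k : 'I_N.+1 => - (1 / (2 * N.+1%:R)) * p k)).
    by rewrite -mulr_sumr; ring.
  by move=> k _; rewrite !mxE.
have starTE : (P^T *m ((Lambda_star N)^T *m S)) 0 0
    = - (s * (\sum_(k < N.+1) p k) / (2 * N.+1%:R)).
  by rewrite -starE -tr11 !trmx_mul !trmxK mulmxA.
have epsTE : (E^T *m ((Lambda_eps a)^T *m P)) 0 0
    = \sum_(j < N) Lambda_coef a j * e j * tail p j.+1.
  by rewrite -quad_eps -tr11 !trmx_mul !trmxK mulmxA.
have nustarE : (S^T *m (nustar%:M *m S)) 0 0 = nustar * s ^+ 2.
  by rewrite /S tr_scalar_mx !mul_scalar_mx !mxE/= !mulr1n; ring.
have tauE : (E^T *m (tau%:M *m E)) 0 0 = tau * \sum_(j < N) e j ^+ 2.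
  rewrite mul_scalar_mx mxE mulr_sumr; apply: eq_bigr => j _.
  by rewrite !mxE; ring.
rewrite !mulmxDr.
have -> (A B C D F G H : 'M[R]_1) : (A + B + (C + D + F) + (G + H)) 0 0
    = A 0 0 + B 0 0 + (C 0 0 + D 0 0 + F 0 0) + (G 0 0 + H 0 0).
  by rewrite !mxE.
rewrite nustarE starE starTE quad_points quad_eps epsTE tauE /lambda_form.
have -> : \sum_(j < N) Lambda_coef a j * (p j + e j) * tail p j.+1
  = \sum_(j < N) Lambda_coef a j * p j * tail p j.+1
    + \sum_(j < N) Lambda_coef a j * e j * tail p j.+1.
  by rewrite -big_split/=; apply: eq_bigr => j _; ring.
by field; rewrite addrC natr1 pnatr_eq0.
Qed.

Lemma tail_split p j : (j < N.+1)%N -> tail p j = p j + tail p j.+1.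
Proof.
move=> jN; rewrite /tail (bigD1 (Ordinal jN))//=; congr (_ + _).
by apply: eq_bigl => k; rewrite -val_eqE/= ltn_neqAle eq_sym andbC.
Qed.

Lemma tail_end p : tail p N.+1 = 0.
Proof. by rewrite /tail big_pred0// => k; rewrite leqNgt ltn_ord. Qed.

Lemma Lambda_sym nustar (nu : N.+1.-tuple R) tau (a : N.-tuple R) :
  (Lambda nustar nu tau a)^T = Lambda nustar nu tau a.
Proof.
rewrite /Lambda !tr_block_mx !tr_scalar_mx !trmxK; congr (block_mx (block_mx _ _ _ _) _ _ _).
by apply/matrixP => i j; rewrite !mxE minnC eq_sym; case: eqP => // ->.
Qed.

Lemma Lambda_psdP nustar (nu : N.+1.-tuple R) tau (a : N.-tuple R) :
  psd (Lambda nustar nu tau a) <->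
  forall s p e, 0 <= lambda_form nustar (nth 0 nu) tau (Lambda_coef a) s p e.
Proof.
split=> [[_ Mx] s p e|Fge0]; first by rewrite -Lambda_quad; exact: Mx.
split=> [|x]; first exact: Lambda_sym.
pose ext n (v : 'cV[R]_n) k := oapp (fun i => v i 0) 0 (insub k : option 'I_n).
have extE n (v : 'cV[R]_n) : \col_(k < n) ext n v k = v.
  by apply/colP => k; rewrite mxE /ext valK.
have := Fge0 (usubmx (usubmx x) 0 0) (ext _ (dsubmx (usubmx x))) (ext _ (dsubmx x)).
by rewrite -Lambda_quad !extE -mx11_scalar !vsubmxK.
Qed.

End QuadraticForm.

(** * Feasible multipliers from a feasible sequence *)

Lemma abel_sum (R : realType) (s A : nat -> R) n :
  \sum_(k < n.+1) s k * (A k - A k.+1)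
  = s 0%N * A 0%N + \sum_(j < n) (s j.+1 - s j) * A j.+1 - s n * A n.+1.
Proof.
elim: n => [|n IH]; first by rewrite big_ord_recr !big_ord0/=; ring.
by rewrite big_ord_recr/= IH [in RHS]big_ord_recr/=; ring.
Qed.

Section UpperMultipliers.
Variables (R : realType) (N : nat).
Implicit Types (c s : R) (y b p e : nat -> R).

(** As p_k = P_k - P_(k+1) for the tails P_k, the terms of index k combine into
    b_k (P_k^2 - P_(k+1)^2); summation by parts moves the differences to b, and
    b_(k+1) - b_k is the square b_k^2. *)
Lemma quad_min_growth b p : (forall k, b k.+1 = b k + b k ^+ 2) ->
  \sum_(k < N.+1) b k * p k ^+ 2 + 2 * \sum_(j < N) b j * p j * tail N p j.+1
  = b 0%N * (\sum_(k < N.+1) p k) ^+ 2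
    + \sum_(j < N) (b j * tail N p j.+1) ^+ 2.
Proof.
move=> bS.
have -> : \sum_(j < N) b j * p j * tail N p j.+1 =
    \sum_(j < N.+1) b j * p j * tail N p j.+1.
  by rewrite [RHS]big_ord_recr/= tail_end mulr0 addr0.
rewrite mulr_sumr -big_split/=.
rewrite (eq_bigr (fun k : 'I_N.+1 =>
    b k * (tail N p k ^+ 2 - tail N p k.+1 ^+ 2))); last first.
  by move=> k _; rewrite (@tail_split _ N p k (ltn_ord k)); ring.
rewrite (abel_sum b (fun k => tail N p k ^+ 2)) tail_end expr0n/= mulr0 subr0.
congr (_ + _); apply: eq_bigr => j _; rewrite bS; ring.
Qed.

Definition min_growth (t : R) k := iter k (fun z => z + z ^+ 2) t.

Lemma min_growth_le (y : nat -> R) : 0 < y 0%N ->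
  (forall k, (k < N)%N -> y k + y k ^+ 2 <= y k.+1) ->
  forall k, (k <= N)%N -> min_growth (y 0%N) k <= y k.
Proof.
move=> y0 yS; elim=> [//|k IH] kN; apply: le_trans (yS _ kN) => /=.
have p : 0 < min_growth (y 0%N) k.
  by apply: (@growth_gt0 _ k) (leqnn k).
by have := IH (ltnW kN); nra.
Qed.

(** The form is c times a sum of squares.  The value of nu_star is the one for
    which the star row is a multiple of row 0, so that the star variable is
    absorbed in the square coming from b_0; the slack y_k - b_k stays on the
    diagonal. *)
Lemma lambda_form_min_growth y c (nu coef : nat -> R) s p e : 0 < c -> 0 < y 0%N ->
  (forall k, (k < N)%N -> y k + y k ^+ 2 <= y k.+1) ->
  (forall k, (k < N.+1)%N -> nu k = c * y k) ->
  (forall j, (j < N)%N -> coef j = c * min_growth (y 0%N) j) ->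
  0 <= lambda_form N (4 * N.+1%:R ^+ 2 * (c * y 0%N))^-1 nu c coef s p e.
Proof.
move=> c0 y0 yS nuE coefE.
set b := min_growth (y 0%N) in coefE.
have n0 : N.+1%:R != 0 :> R by rewrite pnatr_eq0.
pose P0 := \sum_(k < N.+1) p k.
have -> : lambda_form N (4 * N.+1%:R ^+ 2 * (c * y 0%N))^-1 nu c coef s p e =
  c * (y 0%N * (s / (2 * N.+1%:R * (c * y 0%N)) - P0) ^+ 2
       + \sum_(k < N.+1) (y k - b k) * p k ^+ 2
       + \sum_(j < N) (e j + b j * tail N p j.+1) ^+ 2).
  rewrite /lambda_form -/P0.
  rewrite (eq_bigr (fun k : 'I_N.+1 => c * (y k * p k ^+ 2))); last first.
    by move=> k _; rewrite nuE// mulrA.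
  rewrite [X in 2 * X](eq_bigr (fun j : 'I_N => c * (b j * p j * tail N p j.+1
      + b j * e j * tail N p j.+1))); last first.
    by move=> j _; rewrite coefE//; ring.
  rewrite -!mulr_sumr big_split/=.
  have bS k : b k.+1 = b k + b k ^+ 2 by [].
  have := quad_min_growth p bS; rewrite -/P0 {3}/b/=.
  have -> : \sum_(k < N.+1) (y k - b k) * p k ^+ 2 =
      \sum_(k < N.+1) y k * p k ^+ 2 - \sum_(k < N.+1) b k * p k ^+ 2.
    by rewrite -sumrB; apply: eq_bigr => k _; rewrite mulrBl.
  have -> : \sum_(j < N) (e j + b j * tail N p j.+1) ^+ 2 =
      \sum_(j < N) e j ^+ 2 + 2 * \sum_(j < N) b j * e j * tail N p j.+1
      + \sum_(j < N) (b j * tail N p j.+1) ^+ 2.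
    by rewrite mulr_sumr -!big_split/=; apply: eq_bigr => j _; ring.
  set S1 := \sum_(k < N.+1) b k * _; set S2 := \sum_(j < N) b j * p j * _.
  set S3 := \sum_(j < N) (_ * _) ^+ 2 => /(canRL (addrK _)) ->.
  field.
  by rewrite (gt_eqF c0) (gt_eqF y0) nat1r.
rewrite mulr_ge0 ?(ltW c0)// !addr_ge0//.
- by rewrite mulr_ge0 ?sqr_ge0 ?(ltW y0).
- apply: sumr_ge0 => k _; rewrite mulr_ge0 ?sqr_ge0// subr_ge0.
  by rewrite min_growth_le// -ltnS ltn_ord.
- by apply: sumr_ge0 => j _; rewrite sqr_ge0.
Qed.

End UpperMultipliers.

Definition uS_set (R : realType) (L D : R) N sigma : set R :=
  [set v : R | exists (alpha : N.-tuple R) (tau nustar : R)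
                        (nu : N.+1.-tuple R),
      [/\ forall j, (j < N)%N -> 0 <= alpha`_j,
          0 <= tau,
          0 <= nustar /\ (forall k, (k < N.+1)%N -> 0 <= nu`_k),
          psd (Lambda nustar nu tau [tuple alpha`_j * L / D | j < N]) &
          v = tau * sigma ^+ 2 + nustar + \sum_(k < N.+1) nu`_k]]%classic.

Section UpperStepsizes.
Variables (R : realType) (L D : R) (L_gt0 : 0 < L) (D_gt0 : 0 < D).
Variables (N : nat).
Implicit Types (sigma c : R) (y : N.+1.-tuple R).

Lemma nth_mktuple n (f : nat -> R) k : (k < n)%N -> [tuple f i | i < n]`_k = f k.
Proof.
by move=> kn; rewrite -[k]/(nat_of_ord (Ordinal kn)) -tnth_nth tnth_mktuple.
Qed.

Lemma uS_set_growth sigma c y : 0 < c -> 0 < y`_0 ->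
  (forall k, (k < N)%N -> y`_k + y`_k ^+ 2 <= y`_k.+1) ->
  uS_set L D N sigma (c * sigma ^+ 2 + (4 * N.+1%:R ^+ 2 * (c * y`_0))^-1
                      + \sum_(k < N.+1) c * y`_k).
Proof.
move=> c0 y0 yS.
have bpos k : 0 < min_growth y`_0 k by apply: (@growth_gt0 _ k) (leqnn k).
pose al j := 2 * (N - j)%:R * (c * min_growth y`_0 j) * D / L.
exists [tuple al j | j < N], c, (4 * N.+1%:R ^+ 2 * (c * y`_0))^-1.
exists [tuple c * y`_k | k < N.+1]; split.
- move=> j jN; rewrite (nth_mktuple al)// divr_ge0 ?ltW//.
  by rewrite !mulr_gt0// ltr0n subn_gt0.
- exact: ltW.
- split=> [|k kN]; first by rewrite invr_ge0 !mulr_ge0 ?sqr_ge0 ?ltW.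
  rewrite (nth_mktuple (fun k => c * y`_k))// mulr_ge0 ?ltW//.
  exact: (growth_gt0 y0 yS).
- apply/Lambda_psdP => s p e; apply: lambda_form_min_growth => // [k kN|j jN].
    by rewrite (nth_mktuple (fun k => c * y`_k)).
  rewrite /Lambda_coef (nth_mktuple (fun j => [tuple al j | j < N]`_j * L / D))//.
  rewrite (nth_mktuple al)// /al; field.
  by rewrite !gt_eqF//= ltr0n subn_gt0.
- congr (_ + _); apply: eq_bigr => k _.
  by rewrite (nth_mktuple (fun k => c * y`_k)).
Qed.

Lemma uS_set_lbound sigma : lbound (uS_set L D N sigma) 0.
Proof.
move=> v [al [tau [nustar [nu [_ tau0 [ns0 nu0] _ ->]]]]].
apply: addr_ge0; first by apply: addr_ge0 => //; apply: mulr_ge0 => //; exact: sqr_ge0.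
by apply: sumr_ge0 => k _; exact: nu0.
Qed.

Lemma uS_set_neq0 sigma : (uS_set L D N sigma !=set0)%classic.
Proof.
have N1 : N%:R < N%:R + 1 :> R by rewrite ltrDl.
have [y [y0 yS _]] := uL_set_hyperbola sigma N1.
by eexists; exact: (uS_set_growth sigma ltr01 y0 yS).
Qed.

(** With S = sigma^2 + sum y_k, the objective is c S + 1 / (4 (N+1)^2 c y_0).
    The chosen c makes the two terms equal, which is the equality case of the
    arithmetic-geometric mean inequality. *)
Lemma uS_le_uL_point sigma y : 0 < y`_0 ->
  (forall k, (k < N)%N -> y`_k + y`_k ^+ 2 <= y`_k.+1) ->
  uS L D N sigma <=
    Num.sqrt ((sigma ^+ 2 + \sum_(k < N.+1) y`_k) / (N.+1%:R * y`_0)).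
Proof.
move=> y0 yS; set S := sigma ^+ 2 + _.
have S0 : 0 < S by rewrite ltr_wpDl ?sqr_ge0// (sum_growth_gt0 y0 yS).
have n0 : 0 < N.+1%:R :> R by rewrite ltr0n.
have yS0 : 0 < y`_0 * S by rewrite mulr_gt0.
pose r := Num.sqrt (y`_0 * S).
pose q : R := Num.sqrt N.+1%:R.
have r0 : 0 < r by rewrite sqrtr_gt0.
have q0 : 0 < q by rewrite sqrtr_gt0.
have r2 : r ^+ 2 = y`_0 * S by rewrite sqr_sqrtr ?ltW.
have q2 : q ^+ 2 = N.+1%:R by rewrite sqr_sqrtr ?ltW.
pose c := (2 * q ^+ 2 * r)^-1.
have c0 : 0 < c by rewrite invr_gt0 !mulr_gt0// exprn_gt0.
have yE : y`_0 = r ^+ 2 / S by rewrite r2 mulfK// gt_eqF.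
have valE : c * sigma ^+ 2 + (4 * N.+1%:R ^+ 2 * (c * y`_0))^-1
    + \sum_(k < N.+1) c * y`_k = S / (q ^+ 2 * r).
  rewrite -mulr_sumr addrAC -mulrDr -/S -q2 yE /c.
  by field; rewrite !gt_eqF.
have := uS_set_growth sigma c0 y0 yS; rewrite valE => inS.
have infle : inf (uS_set L D N sigma) <= S / (q ^+ 2 * r).
  by apply: ge_inf => //; exists 0; exact: uS_set_lbound.
apply: (le_trans (ler_wpM2l (ltW q0) infle)).
rewrite le_eqVlt; apply/orP; left; apply/eqP.
have ge0 : 0 <= q * (S / (q ^+ 2 * r)).
  by rewrite ltW// mulr_gt0// divr_gt0// mulr_gt0// exprn_gt0.
rewrite -[LHS]ger0_norm// -sqrtr_sqr; congr Num.sqrt.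
by rewrite -q2 yE; field; rewrite !gt_eqF.
Qed.

Lemma uS_le_uL sigma : uS L D N sigma <= uL N sigma.
Proof.
have uS0 : 0 <= uS L D N sigma.
  by rewrite mulr_ge0 ?sqrtr_ge0//; apply: lb_le_inf;
    [exact: uS_set_neq0 | exact: uS_set_lbound].
rewrite -[leLHS]ger0_norm// -sqrtr_sqr; apply: ler_wsqrtr.
apply: lb_le_inf => [|v [y [y0 yS ->]]].
  by eexists; apply: (@uL_set_hyperbola _ N sigma (N%:R + 1)); rewrite ltrDl.
have := uS_le_uL_point sigma y0 yS.
set w := _ / (N.+1%:R * y`_0) => le_w.
have w0 : 0 <= w.
  rewrite divr_ge0 ?mulr_ge0 ?(ltW y0)//.
  by rewrite addr_ge0 ?sqr_ge0// ltW// (sum_growth_gt0 y0 yS).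
by rewrite -(sqr_sqrtr w0) ler_pXn2r// nnegrE sqrtr_ge0.
Qed.

End UpperStepsizes.

(** * Weak duality: ell is at most uS *)

Section LowerBound.
Variables (R : realType) (N : nat).
Implicit Types (nustar tau z : R) (nu c : nat -> R).

Lemma sum_ltn j : \sum_(r < N.+1) (j < r)%:R = (N - j)%:R :> R.
Proof.
elim: N => [|n IH]; first by rewrite big_ord_recr big_ord0/= add0r sub0n.
rewrite big_ord_recr/= IH -natrD; congr _%:R.
have [jn|nj] := leqP j n; first by rewrite ltnS jn addn1 subSn.
rewrite ltnS leqNgt nj addn0.
have /eqP -> : (n - j == 0)%N by rewrite subn_eq0 ltnW.
by have /eqP -> : (n.+1 - j == 0)%N by rewrite subn_eq0.
Qed.

Lemma tail_cst (b : R) j : tail N (fun=> b) j.+1 = (N - j)%:R * b.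
Proof.
rewrite -sum_ltn mulr_suml [LHS]big_mkcond/=; apply: eq_bigr => k _.
by case: ifP => _; rewrite ?mul1r ?mul0r.
Qed.

Lemma tail_delta (b : R) (r : 'I_N.+1) j :
  tail N (fun k => b * (k == r)%:R) j.+1 = (j < r)%:R * b.
Proof.
rewrite /tail; have [jr|rj] := ltnP j r.
  rewrite (bigD1 r)//= eqxx mulr1 mul1r big1 ?addr0// => k /andP[_ kr].
  by rewrite val_eqE (negbTE kr) mulr0.
rewrite mul0r big1// => k jk; rewrite (_ : _ == _ = false) ?mulr0//.
by apply/eqP => kr; move: jk; rewrite kr ltnNge rj.
Qed.

(** Vectors with equal pairwise inner products z are realised as
    g_k = sqrt z f + sqrt (1 - z) f_k, with f, f_0, ..., f_N orthonormal, and
    the Gram matrix is paired with [Lambda] by summing the form over the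
    coordinates.  This lemma is the coordinate along f, and the next one the
    coordinate along f_r. *)
Lemma lambda_form_cst nustar nu tau c s b t :
  lambda_form N nustar nu tau c s (fun=> b)
    (fun j => - (t j * (N - j)%:R * b))
  = nustar * s ^+ 2 - s * b + b ^+ 2 * (\sum_(k < N.+1) nu k)
    + tau * b ^+ 2 * (\sum_(j < N) t j ^+ 2 * (N - j)%:R ^+ 2)
    + 2 * b ^+ 2 * (\sum_(j < N) c j * (1 - t j * (N - j)%:R) * (N - j)%:R).
Proof.
rewrite /lambda_form sumr_const card_ord -[b *+ _]mulr_natr.
rewrite -[tau * b ^+ 2 * _]mulrA -[2 * b ^+ 2 * _]mulrA !mulr_sumr.
have -> : s * (b * N.+1%:R) / N.+1%:R = s * b by rewrite mulrA mulfK ?pnatr_eq0.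
congr (_ - _ + _ + _ + _).
- by apply: eq_bigr => k _; ring.
- by apply: eq_bigr => j _; ring.
- by apply: eq_bigr => j _; rewrite tail_cst; ring.
Qed.

Lemma lambda_form_delta nustar nu tau c s b t (r : 'I_N.+1) :
  lambda_form N nustar nu tau c s (fun k => b * (k == r)%:R)
    (fun j => - (t j * b * (j < r)%:R))
  = nustar * s ^+ 2 - s * b / N.+1%:R + b ^+ 2 * nu r
    + tau * b ^+ 2 * (\sum_(j < N) t j ^+ 2 * (j < r)%:R)
    - 2 * b ^+ 2 * (\sum_(j < N) c j * t j * (j < r)%:R).
Proof.
have delta (f : nat -> R) : \sum_(k < N.+1) f k * (k == r :> nat)%:R = f r.
  rewrite (bigD1 r)//= eqxx mulr1 big1 ?addr0// => k kr.
  by rewrite val_eqE (negbTE kr) mulr0.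
rewrite /lambda_form (delta (fun=> b)).
have -> : \sum_(k < N.+1) nu k * (b * (k == r :> nat)%:R) ^+ 2 = b ^+ 2 * nu r.
  rewrite -(delta (fun k => b ^+ 2 * nu k)); apply: eq_bigr => k _.
  by case: (_ == _) => /=; ring.
rewrite -[tau * b ^+ 2 * _]mulrA -[2 * b ^+ 2 * _]mulrA !mulr_sumr -sumrN.
congr (_ + _ + _).
- by apply: eq_bigr => j _; case: (_ < _)%N => /=; ring.
- apply: eq_bigr => j _; rewrite tail_delta.
  by have [jr|rj] := ltnP j r; [rewrite (ltn_eqF jr)|] => /=; ring.
Qed.

Lemma sum_lambda_form_delta nustar nu tau c s b t :
  \sum_(r < N.+1) lambda_form N nustar nu tau c s (fun k => b * (k == r)%:R)
    (fun j => - (t j * b * (j < r)%:R))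
  = N.+1%:R * nustar * s ^+ 2 - s * b + b ^+ 2 * (\sum_(k < N.+1) nu k)
    + tau * b ^+ 2 * (\sum_(j < N) t j ^+ 2 * (N - j)%:R)
    - 2 * b ^+ 2 * (\sum_(j < N) c j * t j * (N - j)%:R).
Proof.
under eq_bigr do rewrite lambda_form_delta.
rewrite sumrB !big_split/= sumrN !sumr_const card_ord -!mulr_sumr.
have exch (f : nat -> R) : \sum_(r < N.+1) \sum_(j < N) f j * (j < r)%:R
    = \sum_(j < N) f j * (N - j)%:R.
  by rewrite exchange_big/=; apply: eq_bigr => j _; rewrite -mulr_sumr sum_ltn.
rewrite (exch (fun j => t j ^+ 2)) (exch (fun j => c j * t j)).
rewrite -[_ *+ N.+1]mulr_natr -[(s * b / _) *+ N.+1]mulr_natr divfK ?pnatr_eq0//.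
by congr (_ - _ + _ + _ - _); ring.
Qed.

(** The sum of the form over all coordinates of the vectors g_k, eps_j and
    (g_0 + ... + g_N) / (q l), where q l is the norm of that sum. *)
Lemma lambda_form_lower nustar nu tau c z : 0 <= z <= 1 ->
  (forall s p e, 0 <= lambda_form N nustar nu tau c s p e) ->
  Num.sqrt (1 + N%:R * z) / Num.sqrt N.+1%:R <=
    tau * (\sum_(k < N) ((N - k)%:R * z ^+ 2) / (1 + (N - k.+1)%:R * z))
    + nustar + \sum_(k < N.+1) nu k.
Proof.
move=> /andP[z0 z1] Fge0.
have n0 : 0 < N.+1%:R :> R by rewrite ltr0n.
have w0 : 0 < 1 + N%:R * z by rewrite ltr_wpDr// mulr_ge0.
set l := Num.sqrt (1 + _); set q : R := Num.sqrt N.+1%:R.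
have l0 : 0 < l by rewrite sqrtr_gt0.
have q0 : 0 < q by rewrite sqrtr_gt0.
have l2 : l ^+ 2 = 1 + N%:R * z by rewrite sqr_sqrtr ?ltW.
have q2 : q ^+ 2 = N%:R + 1 by rewrite sqr_sqrtr ?ltW// natr1.
pose b := Num.sqrt z; pose a := Num.sqrt (1 - z).
have b2 : b ^+ 2 = z by rewrite sqr_sqrtr.
have a2 : a ^+ 2 = 1 - z by rewrite sqr_sqrtr// subr_ge0.
pose t j := z / (1 + (N - j.+1)%:R * z).
have := Fge0 (q * b / l) (fun=> b) (fun j => - (t j * (N - j)%:R * b)).
rewrite lambda_form_cst b2 => cst_ge0.
have : 0 <= \sum_(r < N.+1) lambda_form N nustar nu tau c (a / (q * l))
    (fun k => a * (k == r)%:R) (fun j => - (t j * a * (j < r)%:R)).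
  by apply: sumr_ge0 => r _; exact: Fge0.
rewrite sum_lambda_form_delta a2 => /(addr_ge0 cst_ge0) {cst_ge0}.
set C1 := \sum_(j < N) c j * (1 - _) * _; set C2 := \sum_(j < N) c j * t j * _.
set T1 := \sum_(j < N) t j ^+ 2 * _ ^+ 2; set T2 := \sum_(j < N) t j ^+ 2 * _.
set V := \sum_(k < N.+1) nu k; set E := (X in _ -> _ <= tau * X + _ + _).
(* t_j is fixed by the orthogonality of g_j + eps_j to the sum of the later
   g_k, whose inner product with each of its terms is z m + (1 - z), m = N - j. *)
have tE (j : 'I_N) : t j * (z * (N - j)%:R + (1 - z)) = z.
  rewrite -(subnSK (ltn_ord j)) -nat1r /t; field.
  by rewrite gt_eqF// ltr_wpDr// mulr_ge0.
(* The coefficient of each c_j vanishes: the bound holds for every step size. *)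
have CE : z * C1 = (1 - z) * C2.
  rewrite /C1 /C2 !mulr_sumr; apply: eq_bigr => j _.
  apply: subr0_eq; transitivity
    (c j * (N - j)%:R * (z - t j * (z * (N - j)%:R + (1 - z)))); first by ring.
  by rewrite tE subrr mulr0.
(* The squared norms of the eps_j are the summands of the equation for ell_nu. *)
have TE : z * T1 + (1 - z) * T2 = E.
  rewrite /T1 /T2 /E !mulr_sumr -big_split/=; apply: eq_bigr => j _.
  transitivity (t j * (t j * (z * (N - j)%:R + (1 - z))) * (N - j)%:R); first by ring.
  by rewrite tE /t; ring.
(* The squared norm of g_0 + ... + g_N is (q l)^2. *)
have key : q ^+ 2 * z + (1 - z) = l ^+ 2 by rewrite q2 l2; ring.
have nustar_coef : (q * b / l) ^+ 2 + N.+1%:R * (a / (q * l)) ^+ 2 = 1.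
  have -> : (q * b / l) ^+ 2 + N.+1%:R * (a / (q * l)) ^+ 2
      = (q ^+ 2 * b ^+ 2 + a ^+ 2) / l ^+ 2.
    by rewrite -natr1 -q2; field; rewrite !gt_eqF.
  by rewrite b2 a2 key divff// gt_eqF// exprn_gt0.
have star_coef : q * b / l * b + a / (q * l) * a = l / q.
  have -> : q * b / l * b + a / (q * l) * a = (q ^+ 2 * b ^+ 2 + a ^+ 2) / (q * l).
    by field; rewrite !gt_eqF.
  by rewrite b2 a2 key; field; rewrite !gt_eqF.
move=> /le_trans sum_ge0; rewrite -subr_ge0; apply: sum_ge0.
rewrite le_eqVlt; apply/orP; left; apply/eqP.
transitivity (nustar * ((q * b / l) ^+ 2 + N.+1%:R * (a / (q * l)) ^+ 2)
  - (q * b / l * b + a / (q * l) * a) + V + tau * (z * T1 + (1 - z) * T2)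
  + 2 * (z * C1 - (1 - z) * C2)); first by ring.
by rewrite nustar_coef star_coef TE CE subrr; ring.
Qed.

End LowerBound.

Lemma ell_le_uS (R : realType) (L D : R) (N : nat) (sigma : R) :
  0 < L -> 0 < D -> 0 <= sigma -> sigma <= Num.sqrt N%:R ->
  ell N sigma <= uS L D N sigma.
Proof.
move=> L0 D0 s0 sN; have [z01 zE] := ell_nu_spec s0 sN.
have q0 : 0 < Num.sqrt N.+1%:R :> R by rewrite sqrtr_gt0 ltr0n.
rewrite /uS -ler_pdivrMl// mulrC; apply: lb_le_inf; first exact: uS_set_neq0.
move=> v [al [tau [nustar [nu [_ _ _ /Lambda_psdP Fge0 ->]]]]].
by rewrite -zE; exact: lambda_form_lower Fge0.
Qed.

Theorem theorem2 (R : realType) (L D : R) (L_gt0 : 0 < L) (D_gt0 : 0 < D)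
    (N : nat) (N_gt0 : (1 <= N)%N)
    (sigma : R) (sigma_ge0 : 0 <= sigma) (sigma_le : sigma <= Num.sqrt N%:R) :
  [/\ (1 - 5 / 2 * (ln (N%:R + 1) / N%:R)) * u sigma <= ell N sigma,
      ell N sigma <= uS L D N sigma,
      uS L D N sigma <= uL N sigma &
      uL N sigma <= u sigma].
Proof.
split; [exact: ell_lower_bound | exact: ell_le_uS | exact: uS_le_uL |].
exact: uL_le_u.
Qed.
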